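(* Let $(M_i,g_i)$, $i=1,2$, be Riemannian manifolds with $m_i=\dim M_i$ and equip $M_1\times M_2$ with the metric $G_{f_1f_2}$. If $f_1$ and $f_2$ are harmonic functions (on $(M_1,g_1)$ and $(M_2,g_2)$ respectively), then $f_1^h$ is harmonic with respect to $G_{f_1f_2}$ if and only if $$\frac{b_1^h\big(c(1-m_1)b_2^v+m_2\big)}{f_1^hf_2^v}+\frac{c^2}{2(1-c^2b_1^hb_2^v)}\Big\{\frac{b_2^v}{f_2^v}\big(\mathrm{grad} f_1(b_1)\big)^h-\frac{c\,(b_1^2)^h}{f_1^h}\big(\mathrm{grad} f_2(b_2)\big)^v\Big\}=0,$$ and, respectively, $f_2^v$ is harmonic with respect to $G_{f_1f_2}$ if and only if $$\frac{b_2^v\big(c(1-m_2)b_1^h+m_1\big)}{f_1^hf_2^v}+\frac{c^2}{2(1-c^2b_1^hb_2^v)}\Big\{\frac{b_1^h}{f_1^h}\big(\mathrm{grad} f_2(b_2)\big)^v-\frac{c\,(b_2^2)^v}{f_2^v}\big(\mathrm{grad} f_1(b_1)\big)^h\Big\}=0.$$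
   Context: $\pi_i:M_1\times M_2\to M_i$ are the projections; $\varphi_1^h=\varphi_1\circ\pi_1$ and $\varphi_2^v=\varphi_2\circ\pi_2$ for functions $\varphi_i$ on $M_i$. $f_i:M_i\to(0,\infty)$ is smooth, $c\in\mathbb R$, and $$G_{f_1f_2}=(f_2^v)^2\pi_1^*g_1+(f_1^h)^2\pi_2^*g_2+c f_1^hf_2^v\,df_1^h\odot df_2^v,\qquad \alpha\odot\beta=\alpha\otimes\beta+\beta\otimes\alpha.$$ $\mathrm{grad} f_i$ is the $g_i$-gradient, $b_i=g_i(\mathrm{grad} f_i,\mathrm{grad} f_i)$, and $\mathrm{grad} f_i(b_i)$ is the derivative of $b_i$ along $\mathrm{grad} f_i$. Standing assumption: $0\le c^2b_1^hb_2^v<1$ everywhere, so that $G_{f_1f_2}$ is a Riemannian metric. Harmonic means annihilated by the Laplace–Beltrami operator of the metric in question. *)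

(* Defs.v *)
From HB Require Import structures.
From mathcomp Require Export all_boot all_order all_algebra.
From mathcomp Require Export all_classical all_reals all_analysis.
Export Order.TTheory GRing.Theory Num.Theory.
Export numFieldNormedType.Exports.

Set Implicit Arguments.
Unset Strict Implicit.
Unset Printing Implicit Defensive.

Local Open Scope classical_set_scope.
Local Open Scope ring_scope.

(* C^oo on the open set U: every iterated partial derivative is (Frechet)
   differentiable, hence in particular continuous, at every point of U. *)
Definition smooth_on (R : realType) (m : nat) (V : normedModType R)
    (U : set 'rV[R]_m) (f : 'rV[R]_m -> V) : Prop :=
  forall (s : seq 'I_m) (x : 'rV[R]_m), U x ->
    differentiable
      (foldr (fun i (h : 'rV[R]_m -> V) => 'D_(delta_mx 0 i) h) f s) x.

(* An atlas is given as a family of charts indexed by the points, the chart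
   [chart p] being defined on an open neighbourhood [dom p] of p; any atlas
   contains such a subfamily, which determines the same smooth structure.
   [chart p] and its inverse [param p] are total functions whose values
   outside [dom p], resp. [chart p @` dom p], are irrelevant. *)
Record charted (R : realType) (m : nat) := Charted {
  carrier :> topologicalType ;
  dom : carrier -> set carrier ;
  chart : carrier -> carrier -> 'rV[R]_m ;
  param : carrier -> 'rV[R]_m -> carrier }.

Record smooth_manifold (R : realType) (m : nat) (M : charted R m) : Prop :=
  SmoothManifold {
  mfd_hausdorff : hausdorff_space M ;
  mfd_second_countable : @second_countable M ;
  mfd_open_dom : forall p : M, open (dom p) ;
  mfd_dom : forall p : M, dom p p ;
  mfd_open_image : forall p : M, open (chart p @` dom p) ;
  mfd_chartK : forall p q : M, dom p q -> param p (chart p q) = q ;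
  mfd_chart_continuous : forall p : M, {within dom p, continuous (chart p)} ;
  mfd_param_continuous : forall p : M,
    {within chart p @` dom p, continuous (@param R m M p)} ;
  mfd_transition : forall p q : M,
    smooth_on (chart p @` (dom p `&` dom q)) (chart q \o param p) }.

Definition smooth_fun (R : realType) (m : nat) (M : charted R m) (f : M -> R) :=
  forall p : M, smooth_on (chart p @` dom p) (f \o param p).

Definition prod_charted (R : realType) (m1 m2 : nat)
    (M1 : charted R m1) (M2 : charted R m2) : charted R (m1 + m2) :=
  @Charted R (m1 + m2) (M1 * M2)%type
    (fun z => dom z.1 `*` dom z.2)
    (fun z w => row_mx (chart z.1 w.1) (chart z.2 w.2))
    (fun z u => (param z.1 (lsubmx u), param z.2 (rsubmx u))).

(* The tangent space at p is identified with R^m by the differential at p of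
   the chart [chart p] attached to p itself. Tangent vectors at p are thus
   elements of 'rV[R]_m, and differentials at p are computed in [chart p]. *)
Definition dfun (R : realType) (m : nat) (M : charted R m)
    (V : normedModType R) (f : M -> V) (p : M) (v : 'rV[R]_m) : V :=
  'd (f \o param p) (chart p p) v.

Definition dmap (R : realType) (m n : nat) (M : charted R m) (N : charted R n)
    (F : M -> N) (p : M) : 'rV[R]_m -> 'rV[R]_n :=
  dfun (fun q => chart (F p) (F q)) p.

(* The i-th coordinate vector field of the chart [chart p], at the point q. *)
Definition coord_field (R : realType) (m : nat) (M : charted R m)
    (p : M) (i : 'I_m) (q : M) : 'rV[R]_m :=
  'd (chart q \o param p) (chart p q) (delta_mx 0 i).

(* Values are bilinear forms on the tangent spaces; bilinearity is part of
   [riemannian_metric]. *)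
Definition tensor2 (R : realType) (m : nat) (M : charted R m) :=
  M -> 'rV[R]_m -> 'rV[R]_m -> R.

Definition gram (R : realType) (m : nat) (M : charted R m) (g : tensor2 M)
    (p q : M) : 'M[R]_m :=
  \matrix_(i, j) g q (coord_field p i q) (coord_field p j q).

Record riemannian_metric (R : realType) (m : nat) (M : charted R m)
    (g : tensor2 M) : Prop := RiemannianMetric {
  metric_linear : forall (p : M) (a : R) (u v w : 'rV[R]_m),
    g p (a *: u + v) w = a * g p u w + g p v w ;
  metric_sym : forall (p : M) (u v : 'rV[R]_m), g p u v = g p v u ;
  metric_pos : forall (p : M) (v : 'rV[R]_m), v != 0 -> 0 < g p v v ;
  metric_smooth : forall (p : M) (i j : 'I_m),
    smooth_on (chart p @` dom p) (fun y => gram g p (param p y) i j : R) }.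

Definition pullback (R : realType) (m n : nat)
    (M : charted R m) (N : charted R n) (F : M -> N) (g : tensor2 N) :
    tensor2 M :=
  fun p v w => g (F p) (dmap F p v) (dmap F p w).

Definition grad (R : realType) (m : nat) (M : charted R m) (g : tensor2 M)
    (f : M -> R) (p : M) : 'rV[R]_m :=
  xget 0 [set X | forall v : 'rV[R]_m, g p X v = dfun f p v].

(* div X = (det g)^(-1/2) \sum_i d_i ((det g)^(1/2) X^i) at p, in the
   coordinates [chart p]; X^i is the i-th component of X there. *)
Definition divergence (R : realType) (m : nat) (M : charted R m) (g : tensor2 M)
    (X : M -> 'rV[R]_m) (p : M) : R :=
  let rho (q : M) : R := Num.sqrt (\det (gram g p q)) in
  let comp (q : M) : 'rV[R]_m := dfun (chart p) q (X q) in
  (\sum_(i < m) 'D_(delta_mx 0 i)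
     (fun y : 'rV[R]_m => rho (param p y) * comp (param p y) 0 i : R)
     (chart p p)) / rho p.

Definition laplacian (R : realType) (m : nat) (M : charted R m)
    (g : tensor2 M) (u : M -> R) : M -> R := divergence g (grad g u).

Definition harmonic_fun (R : realType) (m : nat) (M : charted R m)
    (g : tensor2 M) (u : M -> R) : Prop := forall p : M, laplacian g u p = 0.

(* b = g(grad f, grad f) *)
Definition sqnorm_grad (R : realType) (m : nat) (M : charted R m)
    (g : tensor2 M) (f : M -> R) (p : M) : R := g p (grad g f p) (grad g f p).

(* (grad f)(b), the derivative of b along grad f *)
Definition grad_sqnorm_grad (R : realType) (m : nat) (M : charted R m)
    (g : tensor2 M) (f : M -> R) (p : M) : R :=
  dfun (sqnorm_grad g f) p (grad g f p).

Definition hlift (R : realType) (m1 m2 : nat) (M1 : charted R m1)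
    (M2 : charted R m2) (f : M1 -> R) : prod_charted M1 M2 -> R :=
  fun z => f z.1.

Definition vlift (R : realType) (m1 m2 : nat) (M1 : charted R m1)
    (M2 : charted R m2) (f : M2 -> R) : prod_charted M1 M2 -> R :=
  fun z => f z.2.

(* alpha (.) beta = alpha (x) beta + beta (x) alpha, without the factor 1/2 *)
Definition sym_prod (R : realType) (m : nat) (M : charted R m)
    (alpha beta : M -> 'rV[R]_m -> R) : tensor2 M :=
  fun p v w => alpha p v * beta p w + beta p v * alpha p w.

Definition warped_metric (R : realType) (m1 m2 : nat) (M1 : charted R m1)
    (M2 : charted R m2) (g1 : tensor2 M1) (g2 : tensor2 M2)
    (f1 : M1 -> R) (f2 : M2 -> R) (c : R) : tensor2 (prod_charted M1 M2) :=
  let f1h := hlift (M2 := M2) f1 in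
  let f2v := vlift (M1 := M1) f2 in
  let pi1 : prod_charted M1 M2 -> M1 := fun z => z.1 in
  let pi2 : prod_charted M1 M2 -> M2 := fun z => z.2 in
  fun z v w =>
    f2v z ^+ 2 * pullback pi1 g1 z v w
    + f1h z ^+ 2 * pullback pi2 g2 z v w
    + c * f1h z * f2v z * sym_prod (dfun f1h) (dfun f2v) z v w.

(* Main.v *)
From HB Require Import structures.
Require Import Defs.
From mathcomp Require Import all_boot all_order all_algebra.
From mathcomp Require Import all_classical all_reals all_analysis.
From mathcomp Require Import ring.

Set Implicit Arguments.
Unset Strict Implicit.
Unset Printing Implicit Defensive.

Local Open Scope classical_set_scope.
Local Open Scope ring_scope.

(* Write D = 1 - c^2 b1 b2. In block form the Gram matrix of G is
   [f2^2 g1, c f1 f2 a^T b; c f1 f2 b^T a, f1^2 g2] with a = df1 and b = df2, so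
   by Schur complements its volume density is
   f2^m1 f1^m2 sqrt(D) times the product of the volume densities of g1 and g2,
   and the G-gradient of f1^h is
   (f2^2 D)^-1 grad f1 - c b1 (f1 f2 D)^-1 grad f2.
   In the divergence of this field, harmonicity of f1 and f2 kills the terms
   where the derivative falls on the fluxes of grad f1 and grad f2; the
   remaining terms are logarithmic derivatives of f_i^n f_i^-e / sqrt(D) along
   grad f_i, and they add up to the left-hand side of the equation divided by
   f2 D. *)

(** * Determinants *)

(** The tangent space at a point q is read in the chart attached to q, and that chart may change
    abruptly with q. So [grad g f q] and [metric_mx g q] cannot be differentiated in q as they
    stand: near p everything is moved to the fixed chart of p by [transition_jac] before a
    derivative is taken. G enters through its matrix at each point, whose determinant is explicit,
    and nonzero because D, f1 and f2 are positive. In the divergence, partial derivatives along one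
    factor see the point of the other factor as a constant. The density of G carries sqrt(D) and the
    gradient coefficients carry 1 / D, which leaves 1 / sqrt(D). Hence the one-variable weights K
    f^n / f^e / sqrt(1 - k b), and a single Laplacian formula serves both equivalences. *)

Lemma det_block_schur (F : fieldType) (m n : nat) (A : 'M[F]_m)
    (B : 'M[F]_(m, n)) (C : 'M[F]_(n, m)) (D : 'M[F]_n) :
  A \in unitmx ->
  \det (block_mx A B C D) = \det A * \det (D - C *m invmx A *m B).
Proof.
move=> uA.
have -> : block_mx A B C D =
    block_mx A 0 C 1%:M *m block_mx 1%:M (invmx A *m B) 0
      (D - C *m invmx A *m B).
  rewrite mulmx_block !(mulmx1, mul1mx, mulmx0, mul0mx, addr0, add0r).
  by rewrite mulmxA mulmxV// mul1mx mulmxA subrKC.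
by rewrite det_mulmx det_lblock det_ublock !det1 mulr1 mul1r.
Qed.

(** The bordered matrix with rows (1, v) and (u, 1) has its determinant computed twice, by
    eliminating either diagonal block. *)
Lemma det_1_sub_rank1 (F : fieldType) (n : nat) (u : 'cV[F]_n) (v : 'rV[F]_n) :
  \det (1%:M - u *m v) = 1 - (v *m u) 0 0.
Proof.
have <- : \det (block_mx 1%:M v u 1%:M) = \det (1%:M - u *m v).
  by rewrite det_block_schur ?unitmx1// det1 mul1r invmx1 mulmx1.
have -> : block_mx 1%:M v u 1%:M =
    block_mx (1%:M - v *m u) v 0 1%:M *m block_mx 1%:M 0 u 1%:M.
  by rewrite mulmx_block !(mulmx1, mul1mx, mulmx0, mul0mx, addr0, add0r) subrK.
by rewrite det_mulmx det_lblock det_ublock !det1 !mulr1 det_mx11 !mxE.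
Qed.

Lemma det_sub_rank1 (F : fieldType) (n : nat) (A : 'M[F]_n) (u : 'cV[F]_n)
    (v : 'rV[F]_n) : A \in unitmx ->
  \det (A - u *m v) = \det A * (1 - (v *m invmx A *m u) 0 0).
Proof.
move=> uA; have -> : A - u *m v = A *m (1%:M - invmx A *m u *m v).
  by rewrite mulmxBr mulmx1 !mulmxA mulmxV// mul1mx.
by rewrite det_mulmx det_1_sub_rank1 mulmxA.
Qed.

Lemma unitmx_inj (F : fieldType) (n : nat) (A : 'M[F]_n) :
  (forall v : 'rV_n, v *m A = 0 -> v = 0) -> A \in unitmx.
Proof.
move=> inj; rewrite -row_free_unit -kermx_eq0; apply/eqP/row_matrixP => i.
by rewrite row0; apply: inj; rewrite -row_mul mulmx_ker row0.
Qed.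

(* Along the segment from the identity to A the determinant cannot vanish. *)
Lemma det_posdef_gt0 (R : rcfType) (n : nat) (A : 'M[R]_n) :
  (forall v : 'rV_n, v != 0 -> 0 < (v *m A *m v^T) 0 0) -> 0 < \det A.
Proof.
move=> posA.
have sq_gt0 (v : 'rV[R]_n) : v != 0 -> 0 < (v *m v^T) 0 0.
  move=> v0; rewrite lt_def; apply/andP; split.
    apply: contra v0 => /eqP; rewrite mxE => v0; apply/eqP/rowP => i.
    rewrite mxE; have /psumr_eq0P := v0; move/(_ _ i isT).
    move=> /(_ _)/eqP; rewrite mxE mulf_eq0 orbb => h; apply/eqP/h.
    by move=> j _; rewrite mxE -expr2 sqr_ge0.
  by rewrite mxE sumr_ge0// => j _; rewrite mxE -expr2 sqr_ge0.
pose P (t : R) := (1 - t)%:M + t *: A.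
(* For nonzero v, v P(t) v^T = (1 - t) |v|^2 + t v A v^T is positive, so P(t) has trivial kernel. *)
have detP_neq0 t : 0 <= t <= 1 -> \det (P t) != 0.
  move=> /andP[t0 t1]; rewrite -unitfE -unitmxE; apply: unitmx_inj => v vP.
  apply/eqP/negPn/negP => v0; have := congr1 (fun B => (B *m v^T) 0 0) vP.
  rewrite mul0mx mulmxDr mul_mx_scalar -scalemxAr mulmxDl -!scalemxAl !mxE.
  have := posA v v0; have := sq_gt0 v v0; rewrite !mxE.
  set s := (\sum_(_ < _) _); set r := (\sum_(_ < _) _) => s0 r0.
  move/eqP; rewrite gt_eqF//.
  have [->|t_neq1] := eqVneq t 1; first by rewrite subrr mul0r add0r mul1r.
  apply: ltr_pwDl; last by rewrite mulr_ge0// ltW.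
  by rewrite mulr_gt0// subr_gt0 lt_neqAle t_neq1.
(* The determinant of P(t) is a polynomial in t, so the intermediate value theorem for polynomials
   applies over a real closed field. It equals 1 at 0; a negative value at 1 would force a root in
   between. *)
pose Q : 'M[{poly R}]_n := (1 - 'X)%:M + 'X *: map_mx polyC A.
have QE a : (\det Q).[a] = \det (P a).
  rewrite -[LHS]/(horner_eval a (\det Q)) -det_map_mx; congr (\det _).
  apply/matrixP => i j; rewrite !mxE /= /horner_eval !hornerE; congr (_ + _).
  by rewrite hornerMn !hornerE.
have := detP_neq0 1; rewrite ler01 lexx => /(_ isT).
rewrite neq_lt => /orP[det_lt0|]; last first.
  by rewrite /P subrr scale1r (_ : 0%:M = 0) ?add0r// raddf0.
have [||t t01 /rootP] := @poly_ivt _ (- \det Q) 0 1; first exact: ler01.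
  rewrite !hornerN !QE oppr_le0 oppr_ge0 (ltW det_lt0) andbT.
  by rewrite /P subr0 scale0r addr0 det1 ler01.
by rewrite hornerN QE => /eqP; rewrite oppr_eq0 (negbTE (detP_neq0 _ t01)).
Qed.

(** * Differentials *)

(** Functions are total but chart formulas hold only on the image of the chart; this lemma moves
    derivatives across such local identities. The first-order expansion of f at x is also one of g,
    and such an expansion determines the differential. *)
Lemma near_eq_diff (R : realType) (V W : normedModType R) (f g : V -> W)
    (x : V) : {near x, f =1 g} -> differentiable f x ->
  differentiable g x /\ 'd g x = 'd f x :> (V -> W).
Proof.
move=> fg df.
have fgx : f x = g x by exact: nbhs_singleton fg.
have dg : g \o shift x = cst (g x) + 'd f x +o_ 0 id.
  apply/eqaddoP => e e0.
  have /eqaddoP /(_ e e0) := diff_locally df.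
  rewrite !near_simpl => dfe.
  have fg0 : \forall h \near 0, f (h + x) = g (h + x).
    move: fg; rewrite (near_shift 0); apply: filterS => y /=.
    by rewrite subr0.
  near=> h.
  have <- : (f \o shift x - (cst (f x) + 'd f x)) h =
            (g \o shift x - (cst (g x) + 'd f x)) h.
    by rewrite /= !fctE /= fgx (near fg0 h).
  by near: h.
have dgE := diff_unique (diff_continuous df) dg.
split=> //; apply/diff_locallyP; rewrite dgE; split=> //.
exact: (diff_continuous df).
Unshelve. all: by end_near. Qed.

Lemma diff_rowE (R : realType) (m : nat) (W : normedModType R)
    (f : 'rV[R]_m -> W) (x v : 'rV[R]_m) : differentiable f x ->
  'd f x v = \sum_(i < m) v 0 i *: 'D_(delta_mx 0 i) f x.
Proof.
move=> df; rewrite [in LHS](row_sum_delta v) linear_sum; apply: eq_bigr => i _.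
by rewrite linearZ deriveE.
Qed.

Lemma differentiable_sumf (R : realType) (V W : normedModType R) (I : Type)
    (s : seq I) (P : pred I) (f : I -> V -> W) (x : V) :
  (forall i, P i -> differentiable (f i) x) ->
  differentiable (fun y => \sum_(i <- s | P i) f i y) x.
Proof.
move=> df; elim: s => [|i s IHs].
  by under eq_fun do rewrite big_nil; exact: differentiable_cst.
case Pi: (P i); under eq_fun do rewrite big_cons Pi; last exact: IHs.
by apply: differentiableD; [exact: df|exact: IHs].
Qed.

Lemma differentiable_prodf (R : realType) (V : normedModType R) (I : Type)
    (s : seq I) (P : pred I) (f : I -> V -> R) (x : V) :
  (forall i, P i -> differentiable (f i) x) ->
  differentiable (fun y => \prod_(i <- s | P i) f i y) x.
Proof.
move=> df; elim: s => [|i s IHs].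
  by under eq_fun do rewrite big_nil; exact: differentiable_cst.
case Pi: (P i); under eq_fun do rewrite big_cons Pi; last exact: IHs.
by apply: differentiableM; [exact: df|exact: IHs].
Qed.

Lemma differentiable_det (R : realType) (V : normedModType R) (n : nat)
    (A : V -> 'M[R]_n) (x : V) :
  (forall i j, differentiable (fun y => A y i j : R) x) ->
  differentiable (fun y => \det (A y)) x.
Proof.
move=> dA; apply: differentiable_sumf => s _.
apply: differentiableM; first exact: differentiable_cst.
exact: differentiable_prodf.
Qed.

(** Cramer's rule. [invmx] agrees with the cofactor formula only at invertible matrices, so
    invertibility is required on a whole neighbourhood. *)
Lemma differentiable_invmx (R : realType) (V : normedModType R) (n : nat)
    (A : V -> 'M[R]_n) (x : V) (i j : 'I_n) :
  (forall i j, differentiable (fun y => A y i j : R) x) ->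
  (\forall y \near x, A y \in unitmx) ->
  differentiable (fun y => invmx (A y) i j : R) x.
Proof.
move=> dA uA.
have near_adj : {near x, (fun y => (\det (A y))^-1 * \adj (A y) i j) =1
    (fun y => invmx (A y) i j)}.
  by apply: filterS uA => y uAy; rewrite /invmx uAy !mxE.
apply: (proj1 (near_eq_diff near_adj _)).
apply: differentiableM.
  apply: differentiableV; first exact: differentiable_det.
  by rewrite -unitfE -unitmxE; exact: (nbhs_singleton uA).
under eq_fun do rewrite mxE /cofactor.
apply: differentiableM; first exact: differentiable_cst.
apply: differentiable_det => k l.
by under eq_fun do rewrite !mxE; exact: dA.
Qed.

Lemma differentiable_sqrt (R : realType) (V : normedModType R) (f : V -> R)
    (x : V) : differentiable f x -> 0 < f x ->
  differentiable (fun y => Num.sqrt (f y)) x.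
Proof.
move=> df f0; apply: differentiable_comp => //.
by apply/derivable1_diffP; have [] := is_derive1_sqrt f0.
Qed.

(** Turns directional derivatives into derivatives in one real variable, where the chain rule for
    [Num.sqrt] and the restriction to one block of coordinates become available. *)
Lemma derive_line (R : realType) (V W : normedModType R) (f : V -> W)
    (x v : V) : 'D_v f x = 'D_(1 : R) (fun h : R => f (h *: v + x)) 0.
Proof.
rewrite /derive; set g1 := fun h => h^-1 *: _; set g2 := fun h => h^-1 *: _.
suff -> : g1 = g2 by [].
by apply/funext => h; rewrite /g1 /g2 /= addr0 scale0r add0r [_%:A]mulr1.
Qed.

Lemma is_derive_sqrt (R : realType) (V : normedModType R) (f : V -> R)
    (x v : V) (df : R) : is_derive x v f df -> 0 < f x ->
  is_derive x v (fun y => Num.sqrt (f y)) ((2 * Num.sqrt (f x))^-1 * df).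
Proof.
move=> [/derivable1P dfx dfE] f0; have := is_derive1_sqrt f0.
rewrite -{1}[x]add0r -(scale0r v) => ds.
have dk : is_derive (0 : R) (1 : R) (fun h : R => f (h *: v + x)) df.
  by split=> //; rewrite -derive_line.
have [ck ckE] := is_derive1_comp ds dk.
by split; [apply/derivable1P|rewrite derive_line].
Qed.

(** * Changes of charts and metric matrices *)

(* The differential of the transition map from chart p to chart q at the point
   r, acting on row vectors from the right. It is locked because comparing two of
   these by unfolding does not terminate in reasonable time. *)
HB.lock Definition transition_jac (R : realType) (m : nat) (M : charted R m)
    (p q r : M) : 'M[R]_m := 'J (chart q \o param p) (chart p r).

Lemma transition_jacE (R : realType) (m : nat) (M : charted R m) (p q r : M)
    (v : 'rV[R]_m) :
  'd (chart q \o param p) (chart p r) v = v *m transition_jac p q r.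
Proof. by rewrite transition_jac.unlock mul_rV_lin1. Qed.

Lemma chart_paramK (R : realType) (m : nat) (M : charted R m)
    (hM : smooth_manifold M) (p : M) (y : 'rV[R]_m) :
  (chart p @` dom p) y -> dom p (param p y) /\ chart p (param p y) = y.
Proof. by move=> [q pq <-]; rewrite mfd_chartK. Qed.

Lemma near_chart_image (R : realType) (m : nat) (M : charted R m)
    (hM : smooth_manifold M) (p r : M) : dom p r ->
  \forall y \near chart p r, (chart p @` dom p) y.
Proof.
by move=> pr; apply: open_nbhs_nbhs; split; [exact: mfd_open_image|exists r].
Qed.

Lemma near_param_dom (R : realType) (m : nat) (M : charted R m)
    (hM : smooth_manifold M) (p q r : M) : dom p r -> dom q r ->
  \forall y \near chart p r, dom q (param p y).
Proof.
move=> pr qr.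
have := @mfd_param_continuous _ _ _ hM p.
rewrite continuous_open_subspace; last exact: mfd_open_image.
move=> /(_ (chart p r)) cp.
have {}cp : {for chart p r, continuous (@param R m M p)}.
  by apply: cp; rewrite inE; exists r.
apply: cp; rewrite /= mfd_chartK//.
by apply: open_nbhs_nbhs; split => //; exact: mfd_open_dom.
Qed.

Lemma differentiable_transition (R : realType) (m : nat) (M : charted R m)
    (hM : smooth_manifold M) (p q r : M) : dom p r -> dom q r ->
  differentiable (chart q \o param p) (chart p r).
Proof.
move=> pr qr; have pqr : (chart p @` (dom p `&` dom q)) (chart p r) by exists r.
exact: (@mfd_transition _ _ _ hM p q [::] _ pqr).
Qed.

(** Chain rule through the transition map. The factorisation of [f \o param p] through [chart q] is
    valid only where [param p] lands in [dom q], that is, near [chart p r]. *)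
Lemma diff_chart_change (R : realType) (m : nat) (M : charted R m)
    (V : normedModType R) (hM : smooth_manifold M) (f : M -> V) (p q r : M) :
  dom p r -> dom q r -> differentiable (f \o param q) (chart q r) ->
  differentiable (f \o param p) (chart p r) /\
  forall v, 'd (f \o param p) (chart p r) v =
            'd (f \o param q) (chart q r) (v *m transition_jac p q r).
Proof.
move=> pr qr dfq; have dpq := differentiable_transition hM pr qr.
have E : chart q r = (chart q \o param p) (chart p r) by rewrite /= mfd_chartK.
rewrite E in dfq; have dc := differentiable_comp dpq dfq.
have near_comp : {near chart p r,
    (f \o param q) \o (chart q \o param p) =1 f \o param p}.
  have := near_param_dom hM pr qr; apply: filterS => y qy /=.
  by rewrite mfd_chartK.
have [df dfE] := near_eq_diff near_comp dc.
have cE := diff_comp dpq dfq; rewrite -E in cE.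
split=> [|v]; first exact: df.
rewrite -transition_jacE.
exact: (etrans (congr1 (@^~ v) dfE) (congr1 (@^~ v) cE)).
Qed.

Lemma diff_chart_id (R : realType) (m : nat) (M : charted R m)
    (hM : smooth_manifold M) (p r : M) (v : 'rV[R]_m) : dom p r ->
  'd (chart p \o param p) (chart p r) v = v.
Proof.
move=> pr.
have near_id : {near chart p r, id =1 chart p \o param p}.
  have := near_chart_image hM pr; apply: filterS => y /(chart_paramK hM)[_].
  by move=> /= ->.
by have [_ ->] := near_eq_diff near_id (@ex_diff _ _ _ _ _ _ _ _); rewrite diff_val.
Qed.

(** The change of charts is applied to the map [chart p] itself, whose differential in its own
    coordinates is the identity. *)
Lemma transition_jacK (R : realType) (m : nat) (M : charted R m)
    (hM : smooth_manifold M) (p q r : M) : dom p r -> dom q r ->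
  transition_jac p q r *m transition_jac q p r = 1%:M.
Proof.
move=> pr qr; apply/row_matrixP => i.
have dqp := differentiable_transition hM qr pr.
have [_ E] := diff_chart_change hM pr qr dqp.
by rewrite !rowE mulmxA -transition_jacE -E diff_chart_id// mulmx1.
Qed.

Definition dfun_row (R : realType) (m : nat) (M : charted R m) (f : M -> R)
    (p : M) : 'rV[R]_m := \row_j dfun f p (delta_mx 0 j).

Lemma dfun_rowE (R : realType) (m : nat) (M : charted R m) (f : M -> R) (p : M)
    (v : 'rV[R]_m) : dfun f p v = (dfun_row f p *m v^T) 0 0.
Proof.
rewrite {1}(row_sum_delta v) /dfun linear_sum mxE; apply: eq_bigr => i _.
by rewrite !mxE linearZ mulrC.
Qed.

(** A predicate, so that an explicit matrix such as the block matrix of G is handled by the same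
    lemmas as [metric_mx]. The coordinates are those of the chart attached to q. *)
Definition has_matrix (R : realType) (m : nat) (M : charted R m)
    (g : tensor2 M) (q : M) (A : 'M[R]_m) :=
  forall u v, g q u v = (u *m A *m v^T) 0 0.

(** [grad] is selected by [xget], with default 0 if no vector represents the differential;
    invertibility of A gives existence and uniqueness of that vector. *)
Lemma grad_has_matrix (R : realType) (m : nat) (M : charted R m)
    (g : tensor2 M) (f : M -> R) (q : M) (A : 'M[R]_m) :
  has_matrix g q A -> A \in unitmx ->
  grad g f q = dfun_row f q *m invmx A.
Proof.
move=> gA uA; rewrite /grad; apply: xget_unique => [v /=|Y gY].
  by rewrite gA mulmxKV// dfun_rowE.
suff -> : dfun_row f q = Y *m A by rewrite mulmxK.
apply/rowP => j; rewrite mxE -gY gA trmx_delta -colE mxE.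
by [].
Qed.

(** The rows of [transition_jac p q q] are the coordinate fields of the chart at p, so passing to
    their Gram matrix is a congruence. *)
Lemma gram_has_matrix (R : realType) (m : nat) (M : charted R m)
    (g : tensor2 M) (p q : M) (A : 'M[R]_m) :
  has_matrix g q A ->
  gram g p q = transition_jac p q q *m A *m (transition_jac p q q)^T.
Proof.
move=> gA; apply/matrixP => i j; rewrite mxE gA /coord_field !transition_jacE.
by rewrite trmx_mul trmx_delta !mulmxA -colE mxE -!mulmxA -rowE mxE.
Qed.

Definition metric_mx (R : realType) (m : nat) (M : charted R m)
    (g : tensor2 M) (q : M) : 'M[R]_m :=
  \matrix_(i, j) g q (delta_mx 0 i) (delta_mx 0 j).

Lemma riemannian_has_matrix (R : realType) (m : nat) (M : charted R m)
    (g : tensor2 M) (q : M) : riemannian_metric g ->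
  has_matrix g q (metric_mx g q).
Proof.
move=> hg.
have lin w : linear (fun u => g q u w : R).
  by move=> a u v; rewrite (metric_linear hg).
pose L w : {linear 'rV[R]_m -> R} :=
  HB.pack (fun u => g q u w : R)
    (GRing.isLinear.Build R 'rV[R]_m R *:%R _ (lin w)).
have gl u w : g q u w = \sum_i u 0 i * g q (delta_mx 0 i) w.
  rewrite -[LHS]/(L w u) {1}(row_sum_delta u) linear_sum.
  by apply: eq_bigr => i _; rewrite linearZ.
move=> u v; rewrite gl -mulmxA mxE; apply: eq_bigr => i _; congr (_ * _).
(* [metric_linear] is linearity in the first argument; symmetry carries it to the second. *)
rewrite (Defs.metric_sym hg) gl mxE; apply: eq_bigr => j _.
by rewrite !mxE mulrC (Defs.metric_sym hg).
Qed.

Lemma det_metric_mx_gt0 (R : realType) (m : nat) (M : charted R m)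
    (g : tensor2 M) (q : M) : riemannian_metric g -> 0 < \det (metric_mx g q).
Proof.
move=> hg; apply: det_posdef_gt0 => v v0.
by rewrite -riemannian_has_matrix//; exact: metric_pos.
Qed.

Lemma unitmx_metric_mx (R : realType) (m : nat) (M : charted R m)
    (g : tensor2 M) (q : M) : riemannian_metric g -> metric_mx g q \in unitmx.
Proof.
by move=> hg; rewrite unitmxE unitfE gt_eqF// det_metric_mx_gt0.
Qed.

Lemma grad_mulmx (R : realType) (m : nat) (M : charted R m)
    (g : tensor2 M) (hg : riemannian_metric g) (f : M -> R) (p : M) :
  grad g f p *m metric_mx g p = dfun_row f p.
Proof.
have uA := unitmx_metric_mx p hg.
by rewrite (grad_has_matrix _ (riemannian_has_matrix _ hg) uA) mulmxKV.
Qed.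

Lemma dfun_grad (R : realType) (m : nat) (M : charted R m)
    (g : tensor2 M) (hg : riemannian_metric g) (f : M -> R) (p : M) :
  dfun f p (grad g f p) = sqnorm_grad g f p.
Proof.
by rewrite dfun_rowE /sqnorm_grad (riemannian_has_matrix p hg) grad_mulmx.
Qed.

Lemma grad_mul_dfun_row (R : realType) (m : nat) (M : charted R m)
    (g : tensor2 M) (hg : riemannian_metric g) (f : M -> R) (p : M) :
  grad g f p *m (dfun_row f p)^T = (sqnorm_grad g f p)%:M.
Proof.
rewrite [LHS]mx11_scalar; congr (_ %:M).
rewrite -(dfun_grad hg) dfun_rowE -[in RHS](trmxK (dfun_row f p)) -trmx_mul.
by rewrite [RHS]mxE.
Qed.

(** * Gradients and volume densities in coordinates *)

(* The components in the chart at p of the gradient at q. *)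
Definition local_grad (R : realType) (m : nat) (M : charted R m)
    (g : tensor2 M) (f : M -> R) (p q : M) : 'rV[R]_m :=
  dfun (chart p) q (grad g f q).

(* The partial derivatives of f in the chart at p, computed at q, see
   [local_diff_derive]. *)
Definition local_diff (R : realType) (m : nat) (M : charted R m)
    (f : M -> R) (p q : M) : 'rV[R]_m :=
  dfun_row f q *m (transition_jac p q q)^T.

Definition volume_density (R : realType) (m : nat) (M : charted R m)
    (g : tensor2 M) (p q : M) : R := Num.sqrt (\det (gram g p q)).

Lemma det_gram (R : realType) (m : nat) (M : charted R m)
    (g : tensor2 M) (p q : M) (A : 'M[R]_m) : has_matrix g q A ->
  \det (gram g p q) = \det (transition_jac p q q) ^+ 2 * \det A.
Proof.
by move=> gA; rewrite (gram_has_matrix _ gA) !det_mulmx det_tr expr2 mulrAC.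
Qed.

Lemma det_gram_gt0 (R : realType) (m : nat) (M : charted R m)
    (hM : smooth_manifold M) (g : tensor2 M) (hg : riemannian_metric g)
    (p q : M) : dom p q -> 0 < \det (gram g p q).
Proof.
move=> pq; rewrite (det_gram _ (riemannian_has_matrix _ hg)).
rewrite mulr_gt0 ?det_metric_mx_gt0// lt_def sqr_ge0 andbT sqrf_eq0 -unitfE.
have [uJ _] := mulmx1_unit (transition_jacK hM pq (mfd_dom hM q)).
by rewrite -unitmxE.
Qed.

(** Both factors on the right refer to the fixed chart of p and depend differentiably on q at p;
    this is what makes the components of the gradient differentiable there. *)
Lemma local_gradE (R : realType) (m : nat) (M : charted R m)
    (hM : smooth_manifold M) (g : tensor2 M) (hg : riemannian_metric g)
    (f : M -> R) (p q : M) : dom p q ->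
  local_grad g f p q = local_diff f p q *m invmx (gram g p q).
Proof.
move=> pq; have gA := riemannian_has_matrix q hg.
have uA := unitmx_metric_mx q hg.
have uG : gram g p q \in unitmx.
  by rewrite unitmxE unitfE gt_eqF// det_gram_gt0.
apply: (can_inj (mulmxK uG)); rewrite mulmxKV// (gram_has_matrix _ gA).
rewrite /local_grad /dfun transition_jacE (grad_has_matrix _ gA uA).
rewrite /local_diff !mulmxA; congr (_ *m _).
rewrite -(mulmxA _ (transition_jac q p q)).
by rewrite (transition_jacK hM (mfd_dom hM q) pq) mulmx1 mulmxKV.
Qed.

Lemma local_diff_derive (R : realType) (m : nat) (M : charted R m)
    (hM : smooth_manifold M) (f : M -> R) (p q : M) (j : 'I_m) :
  differentiable (f \o param q) (chart q q) -> dom p q ->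
  local_diff f p q 0 j = 'D_(delta_mx 0 j) (f \o param p) (chart p q).
Proof.
move=> df pq; have [dfp dfE] := diff_chart_change hM pq (mfd_dom hM q) df.
rewrite deriveE// dfE -[RHS]/(dfun f q _) dfun_rowE trmx_mul mulmxA trmx_delta.
by rewrite -colE [RHS]mxE.
Qed.

Lemma smooth_fun_differentiable (R : realType) (m : nat) (M : charted R m)
    (f : M -> R) (p q : M) : smooth_fun f -> dom p q ->
  differentiable (f \o param p) (chart p q).
Proof.
move=> hf pq; have ipq : (chart p @` dom p) (chart p q) by exists q.
exact: (hf p [::] _ ipq).
Qed.

Lemma differentiable_local_diff (R : realType) (m : nat) (M : charted R m)
    (hM : smooth_manifold M) (f : M -> R) (p : M) (j : 'I_m) : smooth_fun f ->
  differentiable (fun y => local_diff f p (param p y) 0 j : R) (chart p p).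
Proof.
move=> hf; have pp := mfd_dom hM p.
have ipp : (chart p @` dom p) (chart p p) by exists p.
have near_D : {near chart p p, 'D_(delta_mx 0 j) (f \o param p) =1
    (fun y => local_diff f p (param p y) 0 j)}.
  have := near_chart_image hM pp; apply: filterS => y /(chart_paramK hM)[py yE].
  rewrite local_diff_derive ?yE//; apply: smooth_fun_differentiable => //.
  exact: mfd_dom.
apply: (proj1 (near_eq_diff near_D _)).
(* With the one-element list, smoothness says that the j-th partial derivative is itself
   differentiable. *)
exact: (hf p [:: j] _ ipp).
Qed.

Lemma differentiable_gram (R : realType) (m : nat) (M : charted R m)
    (hM : smooth_manifold M) (g : tensor2 M) (hg : riemannian_metric g)
    (p : M) (i j : 'I_m) :
  differentiable (fun y => gram g p (param p y) i j : R) (chart p p).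
Proof.
have ipp : (chart p @` dom p) (chart p p) by exists p => //; exact: mfd_dom.
exact: (metric_smooth hg i j [::] ipp).
Qed.

Lemma differentiable_local_grad (R : realType) (m : nat) (M : charted R m)
    (hM : smooth_manifold M) (g : tensor2 M) (hg : riemannian_metric g)
    (f : M -> R) (p : M) (i : 'I_m) : smooth_fun f ->
  differentiable (fun y => local_grad g f p (param p y) 0 i : R) (chart p p).
Proof.
move=> hf; have pp := mfd_dom hM p.
have near_grad : {near chart p p,
    (fun y => \sum_j local_diff f p (param p y) 0 j *
                     invmx (gram g p (param p y)) j i) =1
    (fun y => local_grad g f p (param p y) 0 i)}.
  have := near_chart_image hM pp; apply: filterS => y /(chart_paramK hM)[py yE].
  by rewrite local_gradE// mxE.
apply: (proj1 (near_eq_diff near_grad _)).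
apply: differentiable_sumf => j _; apply: differentiableM.
  exact: differentiable_local_diff.
apply: differentiable_invmx; first by move=> k l; exact: differentiable_gram.
have := near_chart_image hM pp; apply: filterS => y /(chart_paramK hM)[py yE].
by rewrite unitmxE unitfE gt_eqF// det_gram_gt0.
Qed.

Lemma differentiable_volume_density (R : realType) (m : nat) (M : charted R m)
    (hM : smooth_manifold M) (g : tensor2 M) (hg : riemannian_metric g) (p : M) :
  differentiable (fun y => volume_density g p (param p y)) (chart p p).
Proof.
apply: differentiable_sqrt.
  by apply: differentiable_det => i j; exact: differentiable_gram.
by rewrite mfd_chartK ?det_gram_gt0//; exact: mfd_dom.
Qed.

(** Pairing a vector with a covector does not depend on the chart: the two transition Jacobians
    cancel. *)
Lemma sqnorm_gradE (R : realType) (m : nat) (M : charted R m)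
    (hM : smooth_manifold M) (g : tensor2 M) (hg : riemannian_metric g)
    (f : M -> R) (p q : M) : dom p q ->
  sqnorm_grad g f q = (local_grad g f p q *m (local_diff f p q)^T) 0 0.
Proof.
move=> pq; rewrite /local_grad /dfun transition_jacE /local_diff trmx_mul trmxK.
rewrite mulmxA -(mulmxA _ (transition_jac q p q)).
rewrite (transition_jacK hM (mfd_dom hM q) pq) mulmx1 (grad_mul_dfun_row hg).
by rewrite mxE mulr1n.
Qed.

Lemma differentiable_sqnorm_grad (R : realType) (m : nat) (M : charted R m)
    (hM : smooth_manifold M) (g : tensor2 M) (hg : riemannian_metric g)
    (f : M -> R) (p : M) : smooth_fun f ->
  differentiable (sqnorm_grad g f \o param p) (chart p p).
Proof.
move=> hf; have pp := mfd_dom hM p.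
have near_b : {near chart p p,
    (fun y => \sum_j local_grad g f p (param p y) 0 j *
                     local_diff f p (param p y) 0 j) =1
    sqnorm_grad g f \o param p}.
  have := near_chart_image hM pp; apply: filterS => y /(chart_paramK hM)[py yE].
  rewrite /= (sqnorm_gradE hM hg _ py) mxE; apply: eq_bigr => j _.
  by rewrite [in RHS]mxE.
apply: (proj1 (near_eq_diff near_b _)).
apply: differentiable_sumf => j _; apply: differentiableM.
  exact: differentiable_local_grad.
exact: differentiable_local_diff.
Qed.

Lemma local_grad_id (R : realType) (m : nat) (M : charted R m)
    (hM : smooth_manifold M) (g : tensor2 M) (f : M -> R) (p : M) :
  local_grad g f p p = grad g f p.
Proof. by rewrite /local_grad /dfun diff_chart_id//; exact: mfd_dom. Qed.

Lemma sum_local_grad_derive (R : realType) (m : nat) (M : charted R m)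
    (hM : smooth_manifold M) (g : tensor2 M) (f u : M -> R) (p : M) :
  differentiable (u \o param p) (chart p p) ->
  \sum_i local_grad g f p p 0 i * 'D_(delta_mx 0 i) (u \o param p) (chart p p)
  = dfun u p (grad g f p).
Proof. by move=> du; rewrite local_grad_id// /dfun diff_rowE. Qed.

(** * Divergence of a weighted gradient *)

(* The derivative of f is written f x * a, so that a is additive under products. *)
Lemma is_log_deriveM (R : realType) (V : normedModType R) (f g : V -> R)
    (x v : V) (a b : R) :
  is_derive x v f (f x * a) -> is_derive x v g (g x * b) ->
  is_derive x v (fun y => f y * g y) (f x * g x * (a + b)).
Proof.
move=> df dg; apply: is_derive_eq (is_deriveM df dg) _.
by rewrite /GRing.scale /=; ring.
Qed.

Lemma is_log_deriveX (R : realType) (V : normedModType R) (f : V -> R)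
    (x v : V) (a : R) (n : nat) : is_derive x v f (f x * a) ->
  is_derive x v (fun y => f y ^+ n) (f x ^+ n * (n%:R * a)).
Proof.
move=> df; elim: n => [|n IHn].
  by rewrite mul0r mulr0; under eq_fun do rewrite expr0; exact: is_derive_cst.
under eq_fun do rewrite exprS; apply: is_derive_eq (is_log_deriveM df IHn) _.
by rewrite exprS -natr1; ring.
Qed.

Lemma is_log_deriveV (R : realType) (V : normedModType R) (f : V -> R)
    (x v : V) (a : R) : f x != 0 -> is_derive x v f (f x * a) ->
  is_derive x v (fun y => (f y)^-1) ((f x)^-1 * - a).
Proof.
move=> f0 [df dfE]; split; first exact: derivableV.
rewrite (deriveV f0 df) dfE /GRing.scale /=; field.
exact: f0.
Qed.

Lemma is_log_derive_sqrt (R : realType) (V : normedModType R) (f : V -> R)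
    (x v : V) (a : R) : 0 < f x -> is_derive x v f (f x * a) ->
  is_derive x v (fun y => Num.sqrt (f y)) (Num.sqrt (f x) * (a / 2)).
Proof.
move=> f0 df; apply: is_derive_eq (is_derive_sqrt df f0) _.
have s0 : Num.sqrt (f x) != 0 by rewrite gt_eqF// sqrtr_gt0.
rewrite -{2}[f x](sqr_sqrtr (ltW f0)); field.
exact: s0.
Qed.

Lemma derive_flux_weight (R : realType) (V : normedModType R) (F B : V -> R)
    (x v : V) (K k : R) (n e : nat) :
  differentiable F x -> differentiable B x -> F x != 0 -> 0 < 1 - k * B x ->
  let u y := K * (F y ^+ n / F y ^+ e) / Num.sqrt (1 - k * B y) in
  differentiable u x /\
  'D_v u x = u x * ((n%:R - e%:R) * 'D_v F x / F x +
                    k * 'D_v B x / (2 * (1 - k * B x))).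
Proof.
move=> diffF diffB f0 D0 u.
have diffFX i : differentiable (fun y => F y ^+ i) x.
  case: i => [|i]; first exact: differentiable_cst.
  by rewrite -(exprfctE F i.+1); exact: differentiableX.
have sD0 : 0 < Num.sqrt (1 - k * B x) by rewrite sqrtr_gt0.
split.
  apply: differentiableM; first apply: differentiableM.
  - exact: differentiable_cst.
  - apply: differentiableM; first exact: diffFX.
    by apply: differentiableV; [exact: diffFX|rewrite expf_neq0].
  - apply: differentiableV; last by rewrite gt_eqF.
    apply: differentiable_sqrt; last exact: D0.
    apply: differentiableB; first exact: differentiable_cst.
    by apply: differentiableM => //; exact: differentiable_cst.
have dF : is_derive x v F (F x * ('D_v F x / F x)).
  by rewrite mulrC divfK//; apply/derivableP/diff_derivable.
have dD : is_derive x v (fun y => 1 - k * B y)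
    ((1 - k * B x) * (- (k * 'D_v B x) / (1 - k * B x))).
  rewrite [_ * (_ / _)]mulrC divfK ?gt_eqF//.
  have dB := derivableP (diff_derivable (v := v) diffB).
  have h := is_deriveB (is_derive_cst (1 : R) x v)
    (is_deriveM (is_derive_cst (k : R) x v) dB).
  by apply: is_derive_eq h _; rewrite /GRing.scale /=; ring.
have dK : is_derive x v (fun=> K) (K * 0).
  by rewrite mulr0; exact: is_derive_cst.
have dFe := is_log_deriveV (f := fun y => F y ^+ e) (expf_neq0 e f0)
  (is_log_deriveX e dF).
have dS := is_log_deriveV (f := fun y => Num.sqrt (1 - k * B y))
  (lt0r_neq0 sD0) (is_log_derive_sqrt (f := fun y => 1 - k * B y) D0 dD).
have dFne := is_log_deriveM (f := fun y => F y ^+ n)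
  (g := fun y => (F y ^+ e)^-1) (is_log_deriveX n dF) dFe.
have dKF := is_log_deriveM (f := fun=> K)
  (g := fun y => F y ^+ n / F y ^+ e) dK dFne.
have dU := is_log_deriveM (f := fun y => K * (F y ^+ n / F y ^+ e))
  (g := fun y => (Num.sqrt (1 - k * B y))^-1) dKF dS.
have -> : 'D_v u x = _ := @derive_val _ _ _ _ _ _ _ dU.
rewrite /u; congr (_ * _); field.
by rewrite f0 gt_eqF.
Qed.

Lemma sum_derive_weighted (R : realType) (m : nat) (M : charted R m)
    (hM : smooth_manifold M) (g : tensor2 M) (hg : riemannian_metric g)
    (f u : M -> R) (hf : smooth_fun f) (p : M) : laplacian g f p = 0 ->
  differentiable (u \o param p) (chart p p) ->
  \sum_i 'D_(delta_mx 0 i) (fun y => volume_density g p (param p y) *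
      local_grad g f p (param p y) 0 i * u (param p y) : R) (chart p p) =
  volume_density g p p * dfun u p (grad g f p).
Proof.
move=> fp du; have pp := mfd_dom hM p.
pose flux i y := volume_density g p (param p y) * local_grad g f p (param p y) 0 i.
have dflux i : differentiable (flux i) (chart p p).
  apply: differentiableM; first exact: differentiable_volume_density.
  exact: differentiable_local_grad.
(* The Laplacian is this sum divided by a positive density. *)
have flux0 : \sum_i 'D_(delta_mx 0 i) (flux i) (chart p p) = 0.
  move/eqP: fp; rewrite /laplacian /divergence mulf_eq0 => /orP[/eqP//|].
  by rewrite invr_eq0 gt_eqF// sqrtr_gt0 det_gram_gt0.
transitivity (\sum_i (flux i (chart p p) *
    'D_(delta_mx 0 i) (u \o param p) (chart p p)
    + u p * 'D_(delta_mx 0 i) (flux i) (chart p p))).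
  apply: eq_bigr => i _.
  have := @deriveM _ _ (flux i) (u \o param p) (chart p p) (delta_mx 0 i).
  rewrite /= mfd_chartK// => <- //; exact: diff_derivable.
rewrite big_split /= -mulr_sumr flux0 mulr0 addr0.
rewrite -(sum_local_grad_derive hM g f du) mulr_sumr; apply: eq_bigr => i _.
by rewrite /flux mfd_chartK// mulrA.
Qed.

(** Along grad f the function f has derivative b and b has derivative grad f(b), so the logarithmic
    derivative of the weight becomes the bracket on the right. *)
Lemma sum_derive_flux (R : realType) (m : nat) (M : charted R m)
    (hM : smooth_manifold M) (g : tensor2 M) (hg : riemannian_metric g)
    (f : M -> R) (hf : smooth_fun f) (f_gt0 : forall x, 0 < f x) (p : M)
    (K k : R) (n e : nat) : laplacian g f p = 0 ->
  0 < 1 - k * sqnorm_grad g f p ->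
  let u q := K * (f q ^+ n / f q ^+ e) / Num.sqrt (1 - k * sqnorm_grad g f q) in
  \sum_i 'D_(delta_mx 0 i) (fun y => volume_density g p (param p y) *
      local_grad g f p (param p y) 0 i * u (param p y) : R) (chart p p) =
  volume_density g p p * u p *
  ((n%:R - e%:R) * sqnorm_grad g f p / f p +
   k * grad_sqnorm_grad g f p / (2 * (1 - k * sqnorm_grad g f p))).
Proof.
move=> fp D0 u; have pp := mfd_dom hM p.
have diffF := smooth_fun_differentiable hf pp.
have diffB := differentiable_sqnorm_grad hM hg p hf.
have := @derive_flux_weight _ _ (f \o param p) (sqnorm_grad g f \o param p)
  (chart p p) (grad g f p) K k n e diffF diffB.
rewrite /= (mfd_chartK hM pp) gt_eqF// => /(_ isT D0)[diffU DU].
rewrite (sum_derive_weighted hM hg hf fp diffU) -mulrA; congr (_ * _).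
rewrite (deriveE _ diffF) (deriveE _ diffB) in DU.
rewrite -{1}(dfun_grad hg).
exact: etrans (esym (deriveE _ diffU)) DU.
Qed.

(** * Products of charted spaces *)

Lemma linear_rV_continuous (R : realType) (m : nat) (V : normedModType R)
    (f : {linear 'rV[R]_m -> V}) : continuous f.
Proof.
move=> x; apply: differentiable_continuous.
have -> : (f : _ -> _) = fun v : 'rV[R]_m => \sum_i v 0 i *: f (delta_mx 0 i).
  apply/funext => v; rewrite {1}(row_sum_delta v) linear_sum.
  by apply: eq_bigr => i _; rewrite linearZ.
apply: differentiable_sumf => i _; apply: differentiableZl.
exact: differentiable_coord.
Qed.

Lemma diff_comp_linear (R : realType) (m n : nat) (W : normedModType R)
    (L : {linear 'rV[R]_m -> 'rV[R]_n}) (h : 'rV[R]_n -> W) (x : 'rV[R]_m) :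
  differentiable h (L x) ->
  differentiable (h \o L) x /\
  forall v, 'd (h \o L) x v = 'd h (L x) (L v).
Proof.
move=> dh; have dL := linear_differentiable x (linear_rV_continuous (f := L)).
split=> [|v]; first exact: differentiable_comp.
have := congr1 (fun F : _ -> _ => F v) (diff_comp dL dh).
by rewrite /= diff_lin//; exact: linear_rV_continuous.
Qed.

Lemma diff_row_mx (R : realType) (k m n : nat) (h1 : 'rV[R]_k -> 'rV[R]_m)
    (h2 : 'rV[R]_k -> 'rV[R]_n) (x : 'rV[R]_k) :
  differentiable h1 x -> differentiable h2 x ->
  differentiable (fun u => row_mx (h1 u) (h2 u)) x /\
  forall v, 'd (fun u => row_mx (h1 u) (h2 u)) x v =
            row_mx ('d h1 x v) ('d h2 x v).
Proof.
move=> d1 d2.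
have linl : linear (fun a : 'rV[R]_m => row_mx a (0 : 'rV[R]_n)).
  by move=> a u v; rewrite scale_row_mx scaler0 add_row_mx addr0.
have linr : linear (fun a : 'rV[R]_n => row_mx (0 : 'rV[R]_m) a).
  by move=> a u v; rewrite scale_row_mx scaler0 add_row_mx addr0.
pose Ll : {linear 'rV[R]_m -> 'rV[R]_(m + n)} :=
  HB.pack (fun a : 'rV[R]_m => row_mx a (0 : 'rV[R]_n))
    (GRing.isLinear.Build R 'rV[R]_m 'rV[R]_(m + n) *:%R _ linl).
pose Lr : {linear 'rV[R]_n -> 'rV[R]_(m + n)} :=
  HB.pack (fun a : 'rV[R]_n => row_mx (0 : 'rV[R]_m) a)
    (GRing.isLinear.Build R 'rV[R]_n 'rV[R]_(m + n) *:%R _ linr).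
have E : (fun u => row_mx (h1 u) (h2 u)) = (Ll \o h1) + (Lr \o h2).
  by apply/funext => u; rewrite addrfctE /= add_row_mx addr0 add0r.
have dl := linear_differentiable (h1 x) (linear_rV_continuous (f := Ll)).
have dr := linear_differentiable (h2 x) (linear_rV_continuous (f := Lr)).
have dlh := differentiable_comp d1 dl; have drh := differentiable_comp d2 dr.
have Dl v : 'd (Ll \o h1) x v = row_mx ('d h1 x v) 0.
  apply: etrans (congr1 (@^~ v) (diff_comp d1 dl)) _.
  by rewrite /comp diff_lin//; exact: linear_rV_continuous.
have Dr v : 'd (Lr \o h2) x v = row_mx 0 ('d h2 x v).
  apply: etrans (congr1 (@^~ v) (diff_comp d2 dr)) _.
  by rewrite /comp diff_lin//; exact: linear_rV_continuous.
rewrite E; split=> [|v]; first exact: differentiableD.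
apply: etrans (congr1 (@^~ v) (diffD dlh drh)) _.
apply: etrans (congr2 +%R (Dl v) (Dr v)) _.
by rewrite add_row_mx addr0 add0r.
Qed.

(** In product charts the transition map joins the transition maps of the factors, each fed with its
    own half of the coordinates. *)
Lemma prod_transition_jac (R : realType) (m1 m2 : nat)
    (M1 : charted R m1) (M2 : charted R m2)
    (hM1 : smooth_manifold M1) (hM2 : smooth_manifold M2)
    (z w r : prod_charted M1 M2) :
  dom z.1 r.1 -> dom z.2 r.2 -> dom w.1 r.1 -> dom w.2 r.2 ->
  transition_jac z w r =
  block_mx (transition_jac z.1 w.1 r.1) 0 0 (transition_jac z.2 w.2 r.2).
Proof.
move=> z1 z2 w1 w2; apply/row_matrixP => i; rewrite !rowE.
set v := delta_mx 0 i; rewrite -transition_jacE.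
have E1 : lsubmx (chart z r) = chart z.1 r.1 by rewrite /= row_mxKl.
have E2 : rsubmx (chart z r) = chart z.2 r.2 by rewrite /= row_mxKr.
have d1 := differentiable_transition hM1 z1 w1.
have d2 := differentiable_transition hM2 z2 w2.
rewrite -E1 in d1; rewrite -E2 in d2.
have [c1 D1] := diff_comp_linear d1.
have [c2 D2] := diff_comp_linear d2.
have [_ D] := diff_row_mx c1 c2.
apply: etrans (D v) _; rewrite D1 D2 /= row_mxKl row_mxKr !transition_jacE.
rewrite -[in RHS](hsubmxK v) mul_row_block !mulmx0 addr0 add0r.
by [].
Qed.

(** The target V is general because the lemma serves both real functions and the chart-valued maps
    defining [dmap] of the projection. *)
Lemma dfun_hlift (R : realType) (m1 m2 : nat)
    (M1 : charted R m1) (M2 : charted R m2) (V : normedModType R)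
    (f : M1 -> V) (z : prod_charted M1 M2) (v : 'rV[R]_(m1 + m2)) :
  differentiable (f \o param z.1) (chart z.1 z.1) ->
  dfun (fun w : prod_charted M1 M2 => f w.1) z v = dfun f z.1 (lsubmx v).
Proof.
have E1 : lsubmx (chart z z) = chart z.1 z.1 by rewrite /= row_mxKl.
rewrite -E1 => df; have [_ D] := diff_comp_linear df.
by apply: etrans (D v) _; rewrite /= row_mxKl.
Qed.

Lemma dfun_vlift (R : realType) (m1 m2 : nat)
    (M1 : charted R m1) (M2 : charted R m2) (V : normedModType R)
    (f : M2 -> V) (z : prod_charted M1 M2) (v : 'rV[R]_(m1 + m2)) :
  differentiable (f \o param z.2) (chart z.2 z.2) ->
  dfun (fun w : prod_charted M1 M2 => f w.2) z v = dfun f z.2 (rsubmx v).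
Proof.
have E2 : rsubmx (chart z z) = chart z.2 z.2 by rewrite /= row_mxKr.
rewrite -E2 => df; have [_ D] := diff_comp_linear df.
by apply: etrans (D v) _; rewrite /= row_mxKr.
Qed.

Lemma lsubmx_delta (R : realType) (m n : nat) (j : 'I_(m + n)) :
  lsubmx (delta_mx 0 j : 'rV[R]_(m + n)) =
  match fintype.split j with inl k => delta_mx 0 k | inr _ => 0 end.
Proof.
case: split_ordP => k ->; apply/rowP => l.
  by rewrite !mxE eq_lshift.
by rewrite !mxE eq_lrshift.
Qed.

Lemma rsubmx_delta (R : realType) (m n : nat) (j : 'I_(m + n)) :
  rsubmx (delta_mx 0 j : 'rV[R]_(m + n)) =
  match fintype.split j with inl _ => 0 | inr k => delta_mx 0 k end.
Proof.
case: split_ordP => k ->; apply/rowP => l.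
  by rewrite !mxE eq_rlshift.
by rewrite !mxE eq_rshift.
Qed.

Lemma dfun_row_hlift (R : realType) (m1 m2 : nat)
    (M1 : charted R m1) (M2 : charted R m2) (f : M1 -> R)
    (z : prod_charted M1 M2) :
  differentiable (f \o param z.1) (chart z.1 z.1) ->
  dfun_row (hlift f) z = row_mx (dfun_row f z.1) 0.
Proof.
move=> df; apply/rowP => j; rewrite mxE dfun_hlift// lsubmx_delta !mxE.
by case: (fintype.split j) => k; rewrite mxE// /dfun linear0.
Qed.

Lemma dfun_row_vlift (R : realType) (m1 m2 : nat)
    (M1 : charted R m1) (M2 : charted R m2) (f : M2 -> R)
    (z : prod_charted M1 M2) :
  differentiable (f \o param z.2) (chart z.2 z.2) ->
  dfun_row (vlift f) z = row_mx 0 (dfun_row f z.2).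
Proof.
move=> df; apply/rowP => j; rewrite mxE dfun_vlift// rsubmx_delta !mxE.
by case: (fintype.split j) => k; rewrite mxE// /dfun linear0.
Qed.

Definition warped_mx (R : realType) (m1 m2 : nat) (M1 : charted R m1)
    (M2 : charted R m2) (g1 : tensor2 M1) (g2 : tensor2 M2)
    (f1 : M1 -> R) (f2 : M2 -> R) (c : R) (x : M1) (y : M2) :
    'M[R]_(m1 + m2) :=
  let a := dfun_row f1 x in let b := dfun_row f2 y in
  block_mx (f2 y ^+ 2 *: metric_mx g1 x) ((c * f1 x * f2 y) *: (a^T *m b))
    ((c * f1 x * f2 y) *: (b^T *m a)) (f1 x ^+ 2 *: metric_mx g2 y).

Lemma warped_has_matrix (R : realType) (m1 m2 : nat)
    (M1 : charted R m1) (M2 : charted R m2)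
    (hM1 : smooth_manifold M1) (hM2 : smooth_manifold M2)
    (g1 : tensor2 M1) (g2 : tensor2 M2)
    (hg1 : riemannian_metric g1) (hg2 : riemannian_metric g2)
    (f1 : M1 -> R) (f2 : M2 -> R)
    (hf1 : smooth_fun f1) (hf2 : smooth_fun f2) (c : R)
    (z : prod_charted M1 M2) :
  has_matrix (warped_metric g1 g2 f1 f2 c) z (warped_mx g1 g2 f1 f2 c z.1 z.2).
Proof.
move=> v w; have p1 := mfd_dom hM1 z.1; have p2 := mfd_dom hM2 z.2.
have D1 u : dmap (fun z : prod_charted M1 M2 => z.1) z u = lsubmx u.
  rewrite /dmap dfun_hlift; last exact: differentiable_transition.
  exact: diff_chart_id.
have D2 u : dmap (fun z : prod_charted M1 M2 => z.2) z u = rsubmx u.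
  rewrite /dmap dfun_vlift; last exact: differentiable_transition.
  exact: diff_chart_id.
have F1 u : dfun (hlift f1) z u = (dfun_row f1 z.1 *m (lsubmx u)^T) 0 0.
  by rewrite dfun_hlift ?dfun_rowE//; exact: smooth_fun_differentiable.
have F2 u : dfun (vlift f2) z u = (dfun_row f2 z.2 *m (rsubmx u)^T) 0 0.
  by rewrite dfun_vlift ?dfun_rowE//; exact: smooth_fun_differentiable.
rewrite /warped_metric /pullback /sym_prod !D1 !D2 !F1 !F2 /hlift /vlift.
rewrite (riemannian_has_matrix _ hg1) (riemannian_has_matrix _ hg2).
rewrite -[X in _ = (X *m _ *m _) 0 0](hsubmxK v) -[X in _ = (_ *m X^T) 0 0](hsubmxK w).
set v1 := lsubmx v; set v2 := rsubmx v; set w1 := lsubmx w; set w2 := rsubmx w.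
(* A rank-one block pairs two vectors as a product of two differentials, which is one summand of
   [sym_prod]. *)
have cross n1 n2 (s p : 'rV[R]_n1) (q t : 'rV[R]_n2) :
    (s *m (p^T *m q) *m t^T) 0 0 = (p *m s^T) 0 0 * (q *m t^T) 0 0.
  rewrite mulmxA -mulmxA [LHS]mxE big_ord1; congr (_ * _).
  by rewrite -[p *m _]trmxK trmx_mul trmxK [RHS]mxE.
have addE (A B : 'M[R]_1) : (A + B) 0 0 = A 0 0 + B 0 0 by rewrite mxE.
have sclE k (A : 'M[R]_1) : (k *: A) 0 0 = k * A 0 0 by rewrite mxE.
rewrite /warped_mx mul_row_block tr_row_mx mul_row_col !mulmxDl.
rewrite -!scalemxAr -!scalemxAl !addE !sclE !cross.
ring.
Qed.

(** * The matrix and the gradients of the warped metric *)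

Lemma det_warped_mx (R : realType) (m1 m2 : nat)
    (M1 : charted R m1) (M2 : charted R m2) (g1 : tensor2 M1) (g2 : tensor2 M2)
    (hg1 : riemannian_metric g1) (hg2 : riemannian_metric g2)
    (f1 : M1 -> R) (f2 : M2 -> R) (c : R) (x : M1) (y : M2) :
  f1 x != 0 -> f2 y != 0 ->
  \det (warped_mx g1 g2 f1 f2 c x y) =
  (f2 y ^+ m1 * f1 x ^+ m2) ^+ 2 *
  (1 - c ^+ 2 * sqnorm_grad g1 f1 x * sqnorm_grad g2 f2 y) *
  (\det (metric_mx g1 x) * \det (metric_mx g2 y)).
Proof.
move=> f1x f2y.
set b1 := sqnorm_grad g1 f1 x; set b2 := sqnorm_grad g2 f2 y.
have uA1 := unitmx_metric_mx x hg1; have uA2 := unitmx_metric_mx y hg2.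
have uS : f2 y ^+ 2 *: metric_mx g1 x \in unitmx.
  by rewrite unitmxZ ?unitfE ?expf_neq0.
have G1 := grad_has_matrix f1 (riemannian_has_matrix x hg1) uA1.
have G2 := grad_has_matrix f2 (riemannian_has_matrix y hg2) uA2.
rewrite /warped_mx det_block_schur// invmxZ// detZ.
set a := dfun_row f1 x; set b := dfun_row f2 y.
(* Since a A1^-1 a^T = b1 and (c f1 f2)^2 / f2^2 = c^2 f1^2, the Schur complement is f1^2 times a
   rank-one perturbation of the matrix of g2. *)
have -> : f1 x ^+ 2 *: metric_mx g2 y -
    (c * f1 x * f2 y) *: (b^T *m a) *m ((f2 y ^+ 2)^-1 *: invmx (metric_mx g1 x))
      *m ((c * f1 x * f2 y) *: (a^T *m b)) =
    f1 x ^+ 2 *: (metric_mx g2 y - ((c ^+ 2 * b1) *: b^T) *m b).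
  rewrite scalerBr; congr (_ - _).
  rewrite -!(scalemxAl, scalemxAr) !scalerA !mulmxA.
  rewrite -(mulmxA b^T a) -G1 -(mulmxA b^T _ a^T) (grad_mul_dfun_row hg1).
  rewrite mul_mx_scalar -scalemxAl scalerA -/b1; congr (_ *: _).
  field; exact: f2y.
rewrite detZ det_sub_rank1// -G2 -scalemxAr (grad_mul_dfun_row hg2) -/b2.
by rewrite !mxE eqxx mulr1n (exprAC _ 2%N m1) (exprAC _ 2%N m2); ring.
Qed.

Lemma unitmx_warped (R : realType) (m1 m2 : nat)
    (M1 : charted R m1) (M2 : charted R m2) (g1 : tensor2 M1) (g2 : tensor2 M2)
    (hg1 : riemannian_metric g1) (hg2 : riemannian_metric g2)
    (f1 : M1 -> R) (f2 : M2 -> R) (c : R) (x : M1) (y : M2) :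
  f1 x != 0 -> f2 y != 0 ->
  0 < 1 - c ^+ 2 * sqnorm_grad g1 f1 x * sqnorm_grad g2 f2 y ->
  warped_mx g1 g2 f1 f2 c x y \in unitmx.
Proof.
move=> f1x f2y D0; rewrite unitmxE unitfE det_warped_mx//.
by rewrite !mulf_neq0 ?expf_neq0 ?mulf_neq0 ?expf_neq0// gt_eqF//
  ?det_metric_mx_gt0.
Qed.

(** The matrix of G maps combinations of grad f1 and grad f2 to combinations of df1 and df2, so
    finding the two G-gradients is a 2 by 2 linear problem. *)
Lemma mul_row_warped_mx (R : realType) (m1 m2 : nat)
    (M1 : charted R m1) (M2 : charted R m2) (g1 : tensor2 M1) (g2 : tensor2 M2)
    (hg1 : riemannian_metric g1) (hg2 : riemannian_metric g2)
    (f1 : M1 -> R) (f2 : M2 -> R) (c : R) (x : M1) (y : M2) (s t : R) :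
  row_mx (s *: grad g1 f1 x) (t *: grad g2 f2 y) *m warped_mx g1 g2 f1 f2 c x y
  = row_mx
      ((s * f2 y ^+ 2 + t * (c * f1 x * f2 y) * sqnorm_grad g2 f2 y)
         *: dfun_row f1 x)
      ((s * (c * f1 x * f2 y) * sqnorm_grad g1 f1 x + t * f1 x ^+ 2)
         *: dfun_row f2 y).
Proof.
rewrite /warped_mx mul_row_block -!(scalemxAl, scalemxAr) !scalerA.
rewrite !grad_mulmx// !mulmxA !grad_mul_dfun_row// !mul_scalar_mx !scalerA.
by rewrite -!scalerDl.
Qed.

(** The coefficients come from Cramer's rule for that 2 by 2 system, whose determinant is f1^2 f2^2
    D. *)
Lemma grad_warped (R : realType) (m1 m2 : nat)
    (M1 : charted R m1) (M2 : charted R m2)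
    (hM1 : smooth_manifold M1) (hM2 : smooth_manifold M2)
    (g1 : tensor2 M1) (g2 : tensor2 M2)
    (hg1 : riemannian_metric g1) (hg2 : riemannian_metric g2)
    (f1 : M1 -> R) (f2 : M2 -> R)
    (hf1 : smooth_fun f1) (hf2 : smooth_fun f2) (c : R)
    (z : prod_charted M1 M2) :
  f1 z.1 != 0 -> f2 z.2 != 0 ->
  let D := 1 - c ^+ 2 * sqnorm_grad g1 f1 z.1 * sqnorm_grad g2 f2 z.2 in
  0 < D ->
  let G := warped_metric g1 g2 f1 f2 c in
  grad G (hlift f1) z =
    row_mx ((f2 z.2 ^+ 2 * D)^-1 *: grad g1 f1 z.1)
      ((- c * sqnorm_grad g1 f1 z.1 / (f1 z.1 * f2 z.2 * D)) *: grad g2 f2 z.2)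
  /\
  grad G (vlift f2) z =
    row_mx
      ((- c * sqnorm_grad g2 f2 z.2 / (f1 z.1 * f2 z.2 * D)) *: grad g1 f1 z.1)
      ((f1 z.1 ^+ 2 * D)^-1 *: grad g2 f2 z.2).
Proof.
move=> f1z f2z D D0 G.
have gA := warped_has_matrix hM1 hM2 hg1 hg2 hf1 hf2 c z.
have uA := unitmx_warped hg1 hg2 f1z f2z D0.
have Dn0 : D != 0 by rewrite gt_eqF.
rewrite !(grad_has_matrix _ gA uA).
rewrite dfun_row_hlift; last first.
  by apply: smooth_fun_differentiable => //; exact: mfd_dom.
rewrite dfun_row_vlift; last first.
  by apply: smooth_fun_differentiable => //; exact: mfd_dom.
split; apply: (can_inj (mulmxK uA)); rewrite mulmxKV// mul_row_warped_mx//;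
  congr row_mx.
- rewrite -[LHS]scale1r; congr (_ *: _); rewrite /D in Dn0 *.
  by field; rewrite f1z f2z Dn0.
- rewrite -[LHS](scale0r (dfun_row f2 z.2)); congr (_ *: _).
  by field; rewrite f1z f2z Dn0.
- rewrite -[LHS](scale0r (dfun_row f1 z.1)); congr (_ *: _).
  by field; rewrite f1z f2z Dn0.
- rewrite -[LHS]scale1r; congr (_ *: _); rewrite /D in Dn0 *.
  by field; rewrite f1z f2z Dn0.
Qed.

(** * The Laplacian of the warped metric *)

Lemma volume_density_warped (R : realType) (m1 m2 : nat)
    (M1 : charted R m1) (M2 : charted R m2)
    (hM1 : smooth_manifold M1) (hM2 : smooth_manifold M2)
    (g1 : tensor2 M1) (g2 : tensor2 M2)
    (hg1 : riemannian_metric g1) (hg2 : riemannian_metric g2)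
    (f1 : M1 -> R) (f2 : M2 -> R)
    (hf1 : smooth_fun f1) (hf2 : smooth_fun f2) (c : R)
    (z w : prod_charted M1 M2) :
  dom z.1 w.1 -> dom z.2 w.2 -> 0 < f1 w.1 -> 0 < f2 w.2 ->
  let D := 1 - c ^+ 2 * sqnorm_grad g1 f1 w.1 * sqnorm_grad g2 f2 w.2 in
  0 < D ->
  volume_density (warped_metric g1 g2 f1 f2 c) z w =
  f2 w.2 ^+ m1 * f1 w.1 ^+ m2 * Num.sqrt D *
  (volume_density g1 z.1 w.1 * volume_density g2 z.2 w.2).
Proof.
move=> zw1 zw2 f1w f2w D D0.
have gA := warped_has_matrix hM1 hM2 hg1 hg2 hf1 hf2 c w.
have G1 := det_gram_gt0 hM1 hg1 zw1; have G2 := det_gram_gt0 hM2 hg2 zw2.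
have ww1 := mfd_dom hM1 w.1; have ww2 := mfd_dom hM2 w.2.
rewrite /volume_density (det_gram _ gA) prod_transition_jac// det_ublock.
rewrite (det_warped_mx hg1 hg2) ?gt_eqF// -/D.
have -> : (\det (transition_jac z.1 w.1 w.1) *
           \det (transition_jac z.2 w.2 w.2)) ^+ 2 *
    ((f2 w.2 ^+ m1 * f1 w.1 ^+ m2) ^+ 2 * D *
     (\det (metric_mx g1 w.1) * \det (metric_mx g2 w.2))) =
    (f2 w.2 ^+ m1 * f1 w.1 ^+ m2) ^+ 2 * (D *
     (\det (gram g1 z.1 w.1) * \det (gram g2 z.2 w.2))).
  rewrite (det_gram _ (riemannian_has_matrix _ hg1)).
  by rewrite (det_gram _ (riemannian_has_matrix _ hg2)); ring.
(* Positivity of f1 and f2 makes the root of the square the factor itself, without absolute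
   value. *)
rewrite sqrtrM ?sqr_ge0// sqrtr_sqr ger0_norm ?mulr_ge0 ?exprn_ge0 ?ltW//.
by rewrite sqrtrM ?ltW// sqrtrM ?ltW// !mulrA.
Qed.

Lemma local_grad_prod (R : realType) (m1 m2 : nat)
    (M1 : charted R m1) (M2 : charted R m2)
    (hM1 : smooth_manifold M1) (hM2 : smooth_manifold M2)
    (G : tensor2 (prod_charted M1 M2)) (g1 : tensor2 M1) (g2 : tensor2 M2)
    (u : prod_charted M1 M2 -> R) (f1 : M1 -> R) (f2 : M2 -> R) (s t : R)
    (z w : prod_charted M1 M2) : dom z.1 w.1 -> dom z.2 w.2 ->
  grad G u w = row_mx (s *: grad g1 f1 w.1) (t *: grad g2 f2 w.2) ->
  local_grad G u z w = row_mx (s *: local_grad g1 f1 z.1 w.1)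
                              (t *: local_grad g2 f2 z.2 w.2).
Proof.
move=> zw1 zw2 uw; have ww1 := mfd_dom hM1 w.1; have ww2 := mfd_dom hM2 w.2.
rewrite /local_grad /dfun !transition_jacE uw prod_transition_jac//.
by rewrite mul_row_block !mulmx0 addr0 add0r -!scalemxAl.
Qed.

(** Both sides are the derivative at 0 of the same function of one real variable: moving a
    coordinate of the first block leaves the second block fixed. *)
Lemma derive_lshift (R : realType) (m n : nat) (F : 'rV[R]_(m + n) -> R)
    (x1 : 'rV[R]_m) (x2 : 'rV[R]_n) (i : 'I_m) :
  'D_(delta_mx 0 (lshift n i)) F (row_mx x1 x2) =
  'D_(delta_mx 0 i) (fun y => F (row_mx y x2)) x1.
Proof.
rewrite [LHS]derive_line [RHS]derive_line.
suff -> : (fun h : R => F (h *: delta_mx 0 (lshift n i) + row_mx x1 x2)) =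
          (fun h : R => F (row_mx (h *: delta_mx 0 i + x1) x2)) by [].
apply/funext => h; congr F.
have -> : delta_mx 0 (lshift n i) = row_mx (delta_mx 0 i) 0 :> 'rV[R]_(m + n).
  by rewrite -[LHS]hsubmxK lsubmx_delta rsubmx_delta; case: split_ordP => k
    /eqP; rewrite ?eq_lshift ?eq_lrshift// => /eqP ->.
by rewrite scale_row_mx scaler0 add_row_mx add0r.
Qed.

Lemma derive_rshift (R : realType) (m n : nat) (F : 'rV[R]_(m + n) -> R)
    (x1 : 'rV[R]_m) (x2 : 'rV[R]_n) (i : 'I_n) :
  'D_(delta_mx 0 (rshift m i)) F (row_mx x1 x2) =
  'D_(delta_mx 0 i) (fun y => F (row_mx x1 y)) x2.
Proof.
rewrite [LHS]derive_line [RHS]derive_line.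
suff -> : (fun h : R => F (h *: delta_mx 0 (rshift m i) + row_mx x1 x2)) =
          (fun h : R => F (row_mx x1 (h *: delta_mx 0 i + x2))) by [].
apply/funext => h; congr F.
have -> : delta_mx 0 (rshift m i) = row_mx 0 (delta_mx 0 i) :> 'rV[R]_(m + n).
  by rewrite -[LHS]hsubmxK lsubmx_delta rsubmx_delta; case: split_ordP => k
    /eqP; rewrite ?eq_rshift ?eq_rlshift// => /eqP ->.
by rewrite scale_row_mx scaler0 add_row_mx add0r.
Qed.

(* The gradients of both hlift f1 and vlift f2 have this form, with
   (d, e) = (0, 1) and (1, 0). *)
Lemma laplacian_warped (R : realType) (m1 m2 : nat)
    (M1 : charted R m1) (M2 : charted R m2)
    (hM1 : smooth_manifold M1) (hM2 : smooth_manifold M2)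
    (g1 : tensor2 M1) (g2 : tensor2 M2)
    (hg1 : riemannian_metric g1) (hg2 : riemannian_metric g2)
    (f1 : M1 -> R) (f2 : M2 -> R)
    (hf1 : smooth_fun f1) (hf2 : smooth_fun f2)
    (f1_gt0 : forall x, 0 < f1 x) (f2_gt0 : forall y, 0 < f2 y) (c : R)
    (u : prod_charted M1 M2 -> R) (s : M2 -> R) (t : M1 -> R) (d e : nat)
    (z : prod_charted M1 M2) :
  let b1 := sqnorm_grad g1 f1 in
  let b2 := sqnorm_grad g2 f2 in
  let D x y := 1 - c ^+ 2 * b1 x * b2 y in
  let G := warped_metric g1 g2 f1 f2 c in
  (forall x y, 0 < D x y) ->
  (forall w, grad G u w =
    row_mx ((s w.2 / (f1 w.1 ^+ d * D w.1 w.2)) *: grad g1 f1 w.1)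
           ((t w.1 / (f2 w.2 ^+ e * D w.1 w.2)) *: grad g2 f2 w.2)) ->
  laplacian g1 f1 z.1 = 0 -> laplacian g2 f2 z.2 = 0 ->
  laplacian G u z =
  s z.2 / (f1 z.1 ^+ d * D z.1 z.2) *
    ((m2%:R - d%:R) * b1 z.1 / f1 z.1 +
     c ^+ 2 * b2 z.2 * grad_sqnorm_grad g1 f1 z.1 / (2 * D z.1 z.2)) +
  t z.1 / (f2 z.2 ^+ e * D z.1 z.2) *
    ((m1%:R - e%:R) * b2 z.2 / f2 z.2 +
     c ^+ 2 * b1 z.1 * grad_sqnorm_grad g2 f2 z.2 / (2 * D z.1 z.2)).
Proof.
move=> b1 b2 D G D_gt0 gradE lap1 lap2.
have p1 := mfd_dom hM1 z.1; have p2 := mfd_dom hM2 z.2.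
have sqrtD x y : Num.sqrt (D x y) / D x y = (Num.sqrt (D x y))^-1.
  by rewrite -{2}(sqr_sqrtr (ltW (D_gt0 x y))) expr2 invfM mulrA mulfV ?mul1r//
    gt_eqF// sqrtr_gt0.
have vdE w (zw1 : dom z.1 w.1) (zw2 : dom z.2 w.2) : volume_density G z w =
    f2 w.2 ^+ m1 * f1 w.1 ^+ m2 * Num.sqrt (D w.1 w.2) *
    (volume_density g1 z.1 w.1 * volume_density g2 z.2 w.2).
  by apply: volume_density_warped => //; exact: D_gt0.
pose flux (y : 'rV[R]_(m1 + m2)) k :=
  volume_density G z (param z y) * local_grad G u z (param z y) 0 k.
pose v1 := volume_density g1 z.1 z.1; pose v2 := volume_density g2 z.2 z.2.
have lapE : laplacian G u z = (\sum_k 'D_(delta_mx 0 k) (flux^~ k) (chart z z)) /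
    volume_density G z z by [].
rewrite lapE vdE//.
rewrite big_split_ord /=.
(* K1 gathers what depends only on the second point and is constant while differentiating along the
   first factor; K2 is its mirror image. *)
pose K1 := f2 z.2 ^+ m1 * v2 * s z.2; pose K2 := f1 z.1 ^+ m2 * v1 * t z.1.
have S1 : \sum_(i < m1) 'D_(delta_mx 0 (lshift m2 i)) (flux^~ (lshift m2 i))
      (row_mx (chart z.1 z.1) (chart z.2 z.2)) =
    \sum_i 'D_(delta_mx 0 i) (fun y => volume_density g1 z.1 (param z.1 y) *
      local_grad g1 f1 z.1 (param z.1 y) 0 i *
      (K1 * (f1 (param z.1 y) ^+ m2 / f1 (param z.1 y) ^+ d) /
       Num.sqrt (1 - c ^+ 2 * b2 z.2 * b1 (param z.1 y))) : R) (chart z.1 z.1).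
  apply: eq_bigr => i _; rewrite derive_lshift; apply: near_eq_derive.
  have := near_chart_image hM1 p1; apply: filterS => y /(chart_paramK hM1)[py _].
  rewrite /flux /= row_mxKl row_mxKr mfd_chartK//.
  rewrite (vdE (param z.1 y, z.2) py p2) /=.
  rewrite (local_grad_prod hM1 hM2 (z := z) (w := (param z.1 y, z.2)) py p2 (gradE _)) /= row_mxEl mxE.
  rewrite -/v2 /K1 (_ : 1 - _ = D (param z.1 y) z.2); last by rewrite /D mulrAC.
  by rewrite -sqrtD invfM; ring.
have S2 : \sum_(i < m2) 'D_(delta_mx 0 (rshift m1 i)) (flux^~ (rshift m1 i))
      (row_mx (chart z.1 z.1) (chart z.2 z.2)) =
    \sum_i 'D_(delta_mx 0 i) (fun y => volume_density g2 z.2 (param z.2 y) *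
      local_grad g2 f2 z.2 (param z.2 y) 0 i *
      (K2 * (f2 (param z.2 y) ^+ m1 / f2 (param z.2 y) ^+ e) /
       Num.sqrt (1 - c ^+ 2 * b1 z.1 * b2 (param z.2 y))) : R) (chart z.2 z.2).
  apply: eq_bigr => i _; rewrite derive_rshift; apply: near_eq_derive.
  have := near_chart_image hM2 p2; apply: filterS => y /(chart_paramK hM2)[py _].
  rewrite /flux /= row_mxKl row_mxKr mfd_chartK//.
  rewrite (vdE (z.1, param z.2 y) p1 py) /=.
  rewrite (local_grad_prod hM1 hM2 (z := z) (w := (z.1, param z.2 y)) p1 py (gradE _)) /= row_mxEr mxE.
  rewrite -/v1 /K2 -/(D z.1 (param z.2 y)).
  by rewrite -sqrtD invfM; ring.
have DE : 1 - c ^+ 2 * b2 z.2 * b1 z.1 = D z.1 z.2 by rewrite /D mulrAC.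
rewrite S1 S2.
rewrite (sum_derive_flux hM1 hg1 hf1 f1_gt0 K1 m2 d lap1); last by rewrite DE.
rewrite (sum_derive_flux hM2 hg2 hf2 f2_gt0 K2 m1 e lap2); last exact: D_gt0.
rewrite DE -/(D z.1 z.2) -/b1 -/b2 -/v1 -/v2 -!sqrtD /K1 /K2.
have v1n0 : v1 != 0 by rewrite gt_eqF// sqrtr_gt0 det_gram_gt0.
have v2n0 : v2 != 0 by rewrite gt_eqF// sqrtr_gt0 det_gram_gt0.
have D0 : D z.1 z.2 != 0 by rewrite gt_eqF.
have sD0 : Num.sqrt (D z.1 z.2) != 0 by rewrite gt_eqF// sqrtr_gt0.
have f1n0 : f1 z.1 != 0 by rewrite gt_eqF.
have f2n0 : f2 z.2 != 0 by rewrite gt_eqF.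
have f1d := expf_neq0 d f1n0; have f1m := expf_neq0 m2 f1n0.
have f2e := expf_neq0 e f2n0; have f2m := expf_neq0 m1 f2n0.
(* The two brackets already have their final form; naming them leaves only the prefactors to
   [field]. *)
set L1 := _ + _ / (2 * _); set L2 := _ + _ / (2 * _).
field.
by rewrite v1n0 v2n0 D0 sD0 f1d f1m f2e f2m.
Qed.

Theorem corollary2 (R : realType) (m1 m2 : nat)
  (M1 : charted R m1) (M2 : charted R m2)
  (hM1 : smooth_manifold M1) (hM2 : smooth_manifold M2)
  (g1 : tensor2 M1) (g2 : tensor2 M2)
  (hg1 : riemannian_metric g1) (hg2 : riemannian_metric g2)
  (f1 : M1 -> R) (f2 : M2 -> R)
  (hf1 : smooth_fun f1) (hf2 : smooth_fun f2)
  (f1_gt0 : forall x, 0 < f1 x) (f2_gt0 : forall y, 0 < f2 y)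
  (c : R) :
  let b1 := sqnorm_grad g1 f1 in
  let b2 := sqnorm_grad g2 f2 in
  let gb1 := grad_sqnorm_grad g1 f1 in
  let gb2 := grad_sqnorm_grad g2 f2 in
  let G := warped_metric g1 g2 f1 f2 c in
  (forall x y, 0 <= c ^+ 2 * b1 x * b2 y < 1) ->
  harmonic_fun g1 f1 -> harmonic_fun g2 f2 ->
  (harmonic_fun G (hlift f1) <->
    forall (x : M1) (y : M2),
      b1 x * (c * (1 - m1%:R) * b2 y + m2%:R) / (f1 x * f2 y)
      + c ^+ 2 / (2 * (1 - c ^+ 2 * b1 x * b2 y))
        * (b2 y / f2 y * gb1 x - c * b1 x ^+ 2 / f1 x * gb2 y) = 0)
  /\
  (harmonic_fun G (vlift f2) <->
    forall (x : M1) (y : M2),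
      b2 y * (c * (1 - m2%:R) * b1 x + m1%:R) / (f1 x * f2 y)
      + c ^+ 2 / (2 * (1 - c ^+ 2 * b1 x * b2 y))
        * (b1 x / f1 x * gb2 y - c * b2 y ^+ 2 / f2 y * gb1 x) = 0).
Proof.
move=> b1 b2 gb1 gb2 G c2b_bound h1 h2.
pose D x y := 1 - c ^+ 2 * b1 x * b2 y.
have D_gt0 x y : 0 < D x y by rewrite subr_gt0; have /andP[] := c2b_bound x y.
have D_neq0 x y : D x y != 0 by rewrite gt_eqF.
have f1_neq0 x : f1 x != 0 by rewrite gt_eqF.
have f2_neq0 y : f2 y != 0 by rewrite gt_eqF.
have gradG w := grad_warped hM1 hM2 hg1 hg2 hf1 hf2
  (f1_neq0 w.1) (f2_neq0 w.2) (D_gt0 w.1 w.2).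
have lap_hlift x y : laplacian G (hlift f1) (x, y) = (f2 y * D x y)^-1 *
    (b1 x * (c * (1 - m1%:R) * b2 y + m2%:R) / (f1 x * f2 y)
     + c ^+ 2 / (2 * (1 - c ^+ 2 * b1 x * b2 y))
       * (b2 y / f2 y * gb1 x - c * b1 x ^+ 2 / f1 x * gb2 y)).
  (* The coefficients 1 / (f2^2 D) and -c b1 / (f1 f2 D) of the gradient give s, t, d = 0 and e = 1.
     The factor c (1 - m1) of the equation arises from -c (m1 - e), and m2 from m2 - d. *)
  have -> := @laplacian_warped _ _ _ _ _ hM1 hM2 _ _ hg1 hg2 _ _ hf1 hf2
    f1_gt0 f2_gt0 c (hlift f1) (fun y => (f2 y ^+ 2)^-1)
    (fun x => - c * b1 x / f1 x) 0 1 (x, y) D_gt0 _ (h1 x) (h2 y).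
    rewrite -/b1 -/b2 -/(D x y) -/(gb1 x) -/(gb2 y) /=.
    field.
    by rewrite f1_neq0 f2_neq0 D_neq0.
  move=> w; rewrite (gradG w).1 -/b1 -/b2 -/(D _ _).
  congr row_mx; congr (_ *: _); field; by rewrite ?f1_neq0 ?f2_neq0 ?D_neq0.
have lap_vlift x y : laplacian G (vlift f2) (x, y) = (f1 x * D x y)^-1 *
    (b2 y * (c * (1 - m2%:R) * b1 x + m1%:R) / (f1 x * f2 y)
     + c ^+ 2 / (2 * (1 - c ^+ 2 * b1 x * b2 y))
       * (b1 x / f1 x * gb2 y - c * b2 y ^+ 2 / f2 y * gb1 x)).
  have -> := @laplacian_warped _ _ _ _ _ hM1 hM2 _ _ hg1 hg2 _ _ hf1 hf2
    f1_gt0 f2_gt0 c (vlift f2) (fun y => - c * b2 y / f2 y)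
    (fun x => (f1 x ^+ 2)^-1) 1 0 (x, y) D_gt0 _ (h1 x) (h2 y).
    rewrite -/b1 -/b2 -/(D x y) -/(gb1 x) -/(gb2 y) /=.
    field.
    by rewrite f1_neq0 f2_neq0 D_neq0.
  move=> w; rewrite (gradG w).2 -/b1 -/b2 -/(D _ _).
  congr row_mx; congr (_ *: _); field; by rewrite ?f1_neq0 ?f2_neq0 ?D_neq0.
(* Each Laplacian is a nonvanishing factor times the expression in the equation, so the two vanish
   at the same points. *)
have harmonicE (u : prod_charted M1 M2 -> R) (k E : M1 -> M2 -> R) :
    (forall x y, k x y != 0) ->
    (forall x y, laplacian G u (x, y) = (k x y)^-1 * E x y) ->
    harmonic_fun G u <-> forall x y, E x y = 0.
  move=> k0 lapu; split=> [hu x y|E0 [x y]]; last by rewrite lapu E0 mulr0.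
  by have /eqP := hu (x, y); rewrite lapu mulf_eq0 invr_eq0 (negbTE (k0 x y))
    => /eqP.
by split; [apply: harmonicE lap_hlift|apply: harmonicE lap_vlift] => x y;
  rewrite mulf_neq0.
Qed.
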